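(* Let $h:G_1\to G_2$ be a homomorphism of groups. Then $h$ is surjective if and only if the algebraic pullback functor $h^{\ast}:G_2\text{-}\mathbf{set}\to G_1\text{-}\mathbf{set}$ is essentially injective.
   Context: Groups are arbitrary (not necessarily finite). For a group $G$, $G\text{-}\mathbf{set}$ denotes the category of (not necessarily finite or nonempty) right $G$-sets with $G$-equivariant functions as morphisms. For a homomorphism $h:G_1\to G_2$, the algebraic pullback functor $h^{\ast}$ is defined on objects by $h^{\ast}(S):=S$ (same underlying set) with action $s\cdot g_1:=s\cdot h(g_1)$, and on morphisms by $h^{\ast}(t):=t$. A functor $F:C\to D$ is essentially injective provided: for all objects $x,y$ of $C$, if $F(x)\cong F(y)$ then $x\cong y$. *)

(* Defs.v *)
From mathcomp Require Import all_boot boolp.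

Set Implicit Arguments.
Unset Strict Implicit.
Unset Printing Implicit Defensive.

Local Open Scope group_scope.

Record category := Category {
  obj :> Type;
  hom : obj -> obj -> Type;
  idmor : forall x, hom x x;
  ccomp : forall x y z, hom y z -> hom x y -> hom x z;
  ccomp1l : forall x y (f : hom x y), ccomp (idmor y) f = f;
  ccomp1r : forall x y (f : hom x y), ccomp f (idmor x) = f;
  ccompA : forall x y z t (f : hom z t) (g : hom y z) (k : hom x y),
    ccomp f (ccomp g k) = ccomp (ccomp f g) k
}.

Arguments idmor {c} x.
Arguments ccomp {c x y z} f g.

Record functor (C D : category) := Functor {
  fobj :> C -> D;
  fmap : forall x y, hom x y -> hom (fobj x) (fobj y);
  fmap1 : forall x, fmap (idmor x) = idmor (fobj x);
  fmap_comp : forall x y z (f : hom y z) (g : hom x y),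
    fmap (ccomp f g) = ccomp (fmap f) (fmap g)
}.

Definition isomorphic (C : category) (x y : C) : Prop :=
  exists (f : hom x y) (g : hom y x), ccomp g f = idmor x /\ ccomp f g = idmor y.

Definition essentially_injective (C D : category) (F : functor C D) : Prop :=
  forall x y : C, isomorphic (F x) (F y) -> isomorphic x y.

Record gset (G : groupType) := GSet {
  carrier :> Type;
  act : carrier -> G -> carrier;
  act1 : forall s, act s 1 = s;
  actM : forall s g k, act s (g * k) = act (act s g) k
}.

Record equivariant (G : groupType) (S T : gset G) := Equivariant {
  efun :> S -> T;
  equivariantP : forall (s : S) (g : G), efun (act s g) = act (efun s) g
}.

Section GSetCategory.
Variable G : groupType.
Implicit Types S T U V : gset G.

Lemma equivariant_ext S T (f g : equivariant S T) : efun f =1 efun g -> f = g.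
Proof.
case: f g => [f fP] [g gP] /= /funext fg; case: _ / fg in gP *.
by congr Equivariant; exact: Prop_irrelevance.
Qed.

Definition equivariant_id S : equivariant S S :=
  @Equivariant G S S (fun s => s) (fun _ _ => erefl).

Lemma equivariant_compP S T U (f : equivariant T U) (g : equivariant S T) :
  forall (s : S) (x : G), f (g (act s x)) = act (f (g s)) x.
Proof. by move=> s x; rewrite !equivariantP. Qed.

Definition equivariant_comp S T U (f : equivariant T U) (g : equivariant S T) :
  equivariant S U := Equivariant (equivariant_compP f g).

Lemma equivariant_comp1l S T (f : equivariant S T) :
  equivariant_comp (equivariant_id T) f = f.
Proof. exact: equivariant_ext. Qed.

Lemma equivariant_comp1r S T (f : equivariant S T) :
  equivariant_comp f (equivariant_id S) = f.
Proof. exact: equivariant_ext. Qed.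

Lemma equivariant_compA S T U V (f : equivariant U V) (g : equivariant T U)
    (k : equivariant S T) :
  equivariant_comp f (equivariant_comp g k) =
  equivariant_comp (equivariant_comp f g) k.
Proof. exact: equivariant_ext. Qed.

Definition gset_category : category :=
  Category equivariant_comp1l equivariant_comp1r equivariant_compA.

End GSetCategory.

Section AlgebraicPullback.
(* Between [groupType]s, the structure [UMagmaMorphism] (maps preserving [1] and
   products) is exactly that of group homomorphisms. *)
Variables (G1 G2 : groupType) (h : UMagmaMorphism.type G1 G2).

Lemma pullback_act1 (S : gset G2) (s : S) : act s (h 1) = s.
Proof. by rewrite gmulf1 act1. Qed.

Lemma pullback_actM (S : gset G2) (s : S) (g k : G1) :
  act s (h (g * k)) = act (act s (h g)) (h k).
Proof. by rewrite gmulfM actM. Qed.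

Definition pullback_obj (S : gset G2) : gset G1 :=
  @GSet G1 S (fun s g => act s (h g)) (@pullback_act1 S) (@pullback_actM S).

Definition pullback_map (S T : gset G2) (t : equivariant S T) :
    equivariant (pullback_obj S) (pullback_obj T) :=
  @Equivariant G1 (pullback_obj S) (pullback_obj T) t
    (fun s g => equivariantP t s (h g)).

Lemma pullback_map1 (S : gset G2) :
  pullback_map (equivariant_id S) = equivariant_id (pullback_obj S).
Proof. exact: equivariant_ext. Qed.

Lemma pullback_map_comp (S T U : gset G2)
    (f : equivariant T U) (g : equivariant S T) :
  pullback_map (equivariant_comp f g) =
  equivariant_comp (pullback_map f) (pullback_map g).
Proof. exact: equivariant_ext. Qed.

Definition algebraic_pullback :
    functor (gset_category G2) (gset_category G1) :=
  @Functor (gset_category G2) (gset_category G1)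
    pullback_obj pullback_map pullback_map1 pullback_map_comp.

End AlgebraicPullback.

(* Main.v *)
(* If [h] is not surjective, its image [K] is a point of the [G2]-set [Z] of
   proper nonempty subsets of [G2]. This point is fixed by [G1], whereas [G2]
   fixes no point of [Z]. Hence the [G2]-sets [nat * Z] and [1 + nat * Z] are not
   isomorphic, since only the second has a fixed point; but they are isomorphic
   over [G1], by shifting the [nat]-indexed family of fixed points [(n, K)]. *)
Require Import Defs.
From mathcomp Require Import all_boot.
From mathcomp Require Import boolp.

Set Implicit Arguments.
Unset Strict Implicit.
Unset Printing Implicit Defensive.

Local Open Scope group_scope.

Definition fixed_point (G : groupType) (S : gset G) (s : S) : Prop :=
  forall g : G, act s g = s.

Lemma isomorphicP (G : groupType) (S T : gset G) :
  isomorphic (S : gset_category G) T <->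
  exists (f : equivariant S T) (g : equivariant T S),
    cancel f g /\ cancel g f.
Proof.
split=> -[f [g [gf fg]]]; exists f, g; split.
- by move=> s; exact: (congr1 (fun k : equivariant S S => k s) gf).
- by move=> t; exact: (congr1 (fun k : equivariant T T => k t) fg).
- exact: equivariant_ext.
- exact: equivariant_ext.
Qed.

Lemma fixed_point_equivariant (G : groupType) (S T : gset G)
    (f : equivariant S T) (s : S) : fixed_point s -> fixed_point (f s).
Proof. by move=> s_fix g; rewrite -equivariantP s_fix. Qed.

(** Acting by [g] is injective, with inverse the action of [g^-1], which also fixes [t]. *)
Lemma fixed_point_act (G : groupType) (S : gset G) (s t : S) (g : G) :
  fixed_point t -> act s g = t <-> s = t.
Proof.
move=> t_fix; split=> [sg_t|->]; last exact: t_fix.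
by rewrite -[s]act1 -(mulgV g) actM sg_t t_fix.
Qed.

Section Copies.
Variables (G : groupType) (S : gset G).

(** The action on the [nat] index is trivial, so a fixed point of [S] yields an infinite sequence of
    fixed points, with room for a shift. *)
Definition copies : gset G.
Proof.
refine (@GSet G (nat * S) (fun p g => (p.1, act p.2 g)) _ _).
- by move=> [n s]; rewrite act1.
- by move=> [n s] g k; rewrite actM.
Defined.

Definition add_point : gset G.
Proof.
refine (@GSet G (option S) (fun o g => omap (fun s : S => act s g) o) _ _).
- by move=> [s|] //=; rewrite act1.
- by move=> [s|] g k //=; rewrite actM.
Defined.

End Copies.

Section ProperSubsets.
Variable G : groupType.

Definition proper_subset : Type :=
  {P : G -> Prop | (exists x, P x) /\ ~ (forall x, P x)}.

Lemma proper_subset_ext (P Q : proper_subset) : sval P =1 sval Q -> P = Q.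
Proof. by case: P Q => [P nP] [Q nQ] PQ; apply/eq_exist/funext. Qed.

(** This is the right translate [P g]: [x] lies in it iff [x * g^-1] lies in [P]. *)
Definition translate (P : proper_subset) (g : G) : proper_subset.
Proof.
exists (fun x => sval P (x * g^-1)); case: P => P /= [[x Px] nP]; split.
- by exists (x * g); rewrite mulgK.
- by move=> Pall; apply: nP => y; rewrite -(mulgK g y).
Defined.

Definition proper_subsets : gset G.
Proof.
refine (@GSet G proper_subset translate _ _).
- move=> P; apply: proper_subset_ext => x /=; by rewrite invg1 mulg1.
- move=> P g k; apply: proper_subset_ext => x /=; by rewrite invgM mulgA.
Defined.

(** Right translation is transitive on [G]: [x^-1 * y] carries [x] to [y], so an invariant subset
    containing [x] contains every [y]. *)
Lemma proper_subsets_no_fixed_point (P : proper_subsets) : ~ fixed_point P.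
Proof.
move=> P_fix; case: (svalP P) => -[x Px] [] y.
rewrite -(P_fix (x^-1 * y)) /= invgM invgK mulgA mulgV mul1g.
exact: Px.
Qed.

End ProperSubsets.

Lemma add_point_copies_pullback (G1 G2 : groupType)
    (h : UMagmaMorphism.type G1 G2) (S : gset G2) (s0 : S) :
  fixed_point (s0 : pullback_obj h S) ->
  isomorphic (algebraic_pullback h (add_point (copies S)))
             (algebraic_pullback h (copies S)).
Proof.
move=> s0_fix; apply/isomorphicP.
pose X := pullback_obj h (add_point (copies S)).
pose Y := pullback_obj h (copies S).
(* Hilbert's hotel on the copies of [s0]: the added point takes place 0, each [(n, s0)] moves up by
   one, and all other points stay put. The inverse is [g]. *)
pose f (o : option (nat * S)) : nat * S :=
  if o is Some (n, s) then (if `[<s = s0>] then n.+1 else n, s) else (0, s0).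
pose g (p : nat * S) : option (nat * S) :=
  if `[<p.2 = s0>] then (if p.1 is n.+1 then Some (n, p.2) else None)
  else Some p.
(* The case distinction in [f] and [g] is invariant under [G1]; equivariance follows. *)
have act_s0 s x : `[<act s (h x) = s0>] = `[<s = s0>].
  by apply: asbool_equiv_eq; exact: (@fixed_point_act _ (pullback_obj h S)).
have fP (o : X) x : f (act o x) = act (f o : Y) x.
  by case: o => [[n s]|] /=; rewrite ?act_s0 //; congr pair; exact/esym/s0_fix.
have gP (p : Y) x : g (act p x) = act (g p : X) x.
  by case: p => n s; rewrite /g /= act_s0; case: asboolP => //; case: n.
exists (@Equivariant _ X Y f fP), (@Equivariant _ Y X g gP); split=> /=.
- case=> [[n s]|]; rewrite /g /=; last by rewrite asboolT.
  by case: asboolP.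
- by case=> n s; rewrite /g /=; case: asboolP => [->|sP] /=;
    [case: n => //= n; rewrite asboolT | rewrite asboolF].
Qed.

(** Each [y] in [G2] acts as some [h x], so [G1]-equivariant maps between pullbacks are already
    [G2]-equivariant. *)
Lemma pullback_essentially_injective (G1 G2 : groupType)
    (h : UMagmaMorphism.type G1 G2) :
  (forall y : G2, exists x : G1, h x = y) ->
  essentially_injective (algebraic_pullback h).
Proof.
move=> h_surj S T /isomorphicP[f [g [fK gK]]]; apply/isomorphicP.
have lift (U V : gset G2) (k : equivariant (pullback_obj h U) (pullback_obj h V))
    (u : U) (y : G2) : k (act u y) = act (k u : V) y.
  by have [x <-] := h_surj y; exact: (equivariantP k).
by exists (Equivariant (lift _ _ f)), (Equivariant (lift _ _ g)).
Qed.

Lemma essentially_injective_surjective (G1 G2 : groupType)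
    (h : UMagmaMorphism.type G1 G2) :
  essentially_injective (algebraic_pullback h) ->
  forall y : G2, exists x : G1, h x = y.
Proof.
move=> h_inj; apply: contrapT => h_nsurj.
pose im y := exists x, h x = y.
have im_proper : (exists y, im y) /\ ~ (forall y, im y).
  by split=> //; exists 1, 1; rewrite gmulf1.
pose K : proper_subsets G2 := exist _ im im_proper.
have K_fix : fixed_point (K : pullback_obj h (proper_subsets G2)).
  (* The image is closed under right multiplication by [h g] and by its inverse. *)
  move=> g; apply: proper_subset_ext => y /=; apply/propext; split=> -[x xy].
  - by exists (x * g); rewrite gmulfM xy mulgVK.
  - by exists (x * g^-1); rewrite gmulfM gmulfV xy.
have /h_inj/isomorphicP[f _] := add_point_copies_pullback K_fix.
(* [G2] fixes [None], hence its image under [f], whose second component would be an invariant proper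
   subset. *)
have f_fix : fixed_point (f None) by exact: fixed_point_equivariant.
apply: (@proper_subsets_no_fixed_point _ (f None).2) => g.
exact: (congr1 snd (f_fix g)).
Qed.

Theorem corollary5p6 (G1 G2 : groupType) (h : UMagmaMorphism.type G1 G2) :
  (forall y : G2, exists x : G1, h x = y) <->
  essentially_injective (algebraic_pullback h).
Proof.
split; first exact: pullback_essentially_injective.
exact: essentially_injective_surjective.
Qed.
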